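(* For all $n, m_0,m_1,\ldots,m_n \in \mathbb{Z}_+=\{0,1,2,\dots\}$ with $n\sum_{i=0}^{n}m_i > \sum_{i=1}^{n} i m_i$, $$\sum_{j=0}^{n\sum_{i=0}^{n}m_i-\sum_{i=1}^n i m_i}\binom{n\sum_{i=0}^{n}m_i-\sum_{i=1}^n i m_i}{j}(-1)^{j}E_{\sum_{i=1}^n i m_i+j} = \begin{cases} 2+E_{nm_0+nm_1+\cdots+nm_n} & \text{if } \sum_{i=1}^{n} i m_i=0,\\[2mm] \displaystyle\sum_{j=0}^{\sum_{i=1}^n i m_i}\binom{\sum_{i=1}^n i m_i}{j}(-1)^{\sum_{i=1}^n i m_i-j}E_{n\sum_{i=0}^{n}m_i-j} & \text{if } \sum_{i=1}^{n} i m_i>0.\end{cases}$$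
   Context: The Euler numbers $E_n\in\mathbb{Q}$ ($n\ge 0$) are defined by $\frac{2}{e^t+1} = \sum_{n=0}^{\infty} E_n \frac{t^n}{n!}$. *)

(* Defs.v *)
From HB Require Import structures.
From mathcomp Require Import all_boot all_order all_algebra.

Set Implicit Arguments.
Unset Strict Implicit.
Unset Printing Implicit Defensive.

Import Order.TTheory GRing.Theory Num.Theory.
Local Open Scope ring_scope.

(* A formal power series in t over rat is its coefficient sequence:
   [f] stands for \sum_n f n * t^n. *)
Definition fps := nat -> rat.

Definition fps_const (c : rat) : fps := fun n => if n == 0%N then c else 0.

Definition fps_add (f g : fps) : fps := fun n => f n + g n.

Definition fps_mul (f g : fps) : fps :=
  fun n => \sum_(i < n.+1) f i * g (n - i)%N.

Definition fps_exp : fps := fun n => (n`!)%:R^-1.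

(* The first [n] coefficients of f / g, obtained by solving
   (q * g)_k = f_k for q_k; meaningful only when g 0 != 0. *)
Fixpoint fps_div_seq (f g : fps) (n : nat) : seq rat :=
  if n is k.+1 then
    let s := fps_div_seq f g k in
    rcons s ((f k - \sum_(i < k) s`_i * g (k - i)%N) / g 0%N)
  else [::].

Definition fps_div (f g : fps) : fps := fun n => (fps_div_seq f g n.+1)`_n.

(* 2 / (e^t + 1) = \sum_n E_n * t^n / n! *)
Definition Euler (n : nat) : rat :=
  (n`!)%:R * fps_div (fps_const 2) (fps_add fps_exp (fps_const 1)) n.

Lemma size_fps_div_seq f g n : size (fps_div_seq f g n) = n.
Proof. by elim: n => //= n IHn; rewrite size_rcons IHn. Qed.

Lemma nth_fps_div_seq f g n i :
  (i < n)%N -> (fps_div_seq f g n)`_i = fps_div f g i.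
Proof.
elim: n => // n IHn; rewrite ltnS leq_eqVlt => /predU1P[->//|ltin].
by rewrite /= nth_rcons size_fps_div_seq ltin IHn.
Qed.

Lemma fps_divE f g n :
  fps_div f g n = (f n - \sum_(i < n) fps_div f g i * g (n - i)%N) / g 0%N.
Proof.
rewrite {1}/fps_div /= nth_rcons size_fps_div_seq ltnn eqxx.
by congr ((_ - _) / _); apply: eq_bigr => i _; rewrite nth_fps_div_seq.
Qed.

Lemma fps_divK f g : g 0%N != 0 -> fps_mul (fps_div f g) g =1 f.
Proof.
move=> g0 n; rewrite /fps_mul big_ord_recr /= subnn (fps_divE f g n).
by rewrite divfK // addrC subrK.
Qed.

Lemma fps_div_unique f g q :
  g 0%N != 0 -> fps_mul q g =1 f -> q =1 fps_div f g.
Proof.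
move=> g0 qg n; have [m] := ubnP n; elim: m n => // m IHm n le_n_m.
rewrite fps_divE -qg /fps_mul big_ord_recr /= subnn addrC.
under [X in _ - X]eq_bigr => i _.
  rewrite -IHm; last by apply: leq_trans (ltn_ord i) _.
  over.
by rewrite addrK mulfK.
Qed.

Lemma fps_exp1_neq0 : fps_add fps_exp (fps_const 1) 0%N != 0.
Proof. by []. Qed.

Lemma Euler_gen :
  fps_mul (fun n => Euler n / (n`!)%:R) (fps_add fps_exp (fps_const 1))
    =1 fps_const 2.
Proof.
move=> n; rewrite -(fps_divK (fps_const 2) fps_exp1_neq0).
apply: eq_bigr => i _; congr (_ * _); rewrite /Euler mulrC mulKf //.
by rewrite pnatr_eq0 -lt0n fact_gt0.
Qed.

(* Main.v *)
(** Let [L] be the linear functional on rational polynomials with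
    [L X^n = E_n].  The generating function says [L p(X+1) + L p = 2 p(0)], and
    this determines [L].  As [p |-> 2 p(0) - L p(-X)] satisfies the same
    equation, it is [L]; combining both facts,
    [L p(1-X) = L p + 2 (p(1) - p(0))].  With [a = N - S] and [b = S], the two
    sums are [L (X^b (1-X)^a)] and [L (X^a (1-X)^b)], and the correction term
    vanishes for [a, b > 0] and is [2] for [b = 0]. *)

Require Import Defs.
From HB Require Import structures.
From mathcomp Require Import all_boot all_order all_algebra.
From mathcomp Require Import ring lra.

Set Implicit Arguments.
Unset Strict Implicit.
Unset Printing Implicit Defensive.

Import Order.TTheory GRing.Theory Num.Theory.
Local Open Scope ring_scope.

(** Compare coefficients of [t^n] in [Euler_gen] and multiply by [n!]: the factor [e^t] gives the
    binomial sum, the constant 1 the lone [Euler n]. *)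
Lemma Euler_rec n :
  \sum_(i < n.+1) ('C(n, i))%:R * Euler i + Euler n
    = if n == 0%N then 2 else 0.
Proof.
have factn0 k : (k`!)%:R != 0 :> rat by rewrite pnatr_eq0 -lt0n fact_gt0.
transitivity ((n`!)%:R * fps_const 2 n); last first.
  by rewrite /fps_const; case: eqP => [->|_]; rewrite ?mulr0 ?mul1r.
rewrite -Euler_gen /fps_mul mulr_sumr.
under [RHS]eq_bigr do rewrite /fps_add !mulrDr.
rewrite big_split /=; congr (_ + _).
  apply: eq_bigr => i _; have le_in : (i <= n)%N by rewrite -ltnS.
  rewrite /fps_exp -(bin_fact le_in) !natrM.
  by field; rewrite !factn0.
rewrite big_ord_recr /= big1 => [|i _]; rewrite /fps_const.
  by rewrite add0r subnn eqxx mulr1 mulrC divfK.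
by rewrite subn_eq0 leqNgt ltn_ord !mulr0.
Qed.

Definition euler_functional (p : {poly rat}) : rat :=
  \sum_(i < size p) p`_i * Euler i.

Lemma euler_functional_widen k (p : {poly rat}) :
  (size p <= k)%N -> euler_functional p = \sum_(i < k) p`_i * Euler i.
Proof.
move=> le_pk; rewrite /euler_functional (big_ord_widen k (fun i => p`_i * Euler i)) //.
rewrite big_mkcond; apply: eq_bigr => i _; case: ltnP => // le_pi.
by rewrite nth_default // mul0r.
Qed.

Lemma euler_functional_is_linear : linear_for *%R euler_functional.
Proof.
(* The summation range depends on the size of the polynomial; [k] is a common range for all
   three. *)
move=> a p q; pose k := maxn (size (a *: p + q)) (maxn (size p) (size q)).
rewrite !(@euler_functional_widen k) ?leq_max ?leqnn ?orbT //.
rewrite mulr_sumr -big_split; apply: eq_bigr => i _.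
by rewrite coefD coefZ mulrDl mulrA.
Qed.

HB.instance Definition _ := GRing.isLinear.Build rat {poly rat} rat *%R
  euler_functional euler_functional_is_linear.

Lemma euler_functionalXn n : euler_functional 'X^n = Euler n.
Proof.
rewrite (@euler_functional_widen n.+1) ?size_polyXn // big_ord_recr /=.
rewrite coefXn eqxx mul1r big1 ?add0r // => i _.
by rewrite coefXn ltn_eqF ?mul0r.
Qed.

Lemma XD1_exp n :
  ('X + 1) ^+ n = \sum_(i < n.+1) ('C(n, i))%:R *: 'X^i :> {poly rat}.
Proof.
rewrite addrC exprDn; apply: eq_bigr => i _.
by rewrite expr1n mul1r scaler_nat.
Qed.

(** The top term of [('X + 1) ^+ n] is ['X^n], so the hypothesis at ['X^n] reads [2 * f 'X^n = 0]
    once [f] vanishes on lower powers. *)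
Lemma linear_shift_eq0 (f : {linear {poly rat} -> rat | *%R}) :
  (forall p, f (p \Po ('X + 1)) + f p = 0) -> f =1 (fun=> 0).
Proof.
move=> f_shift p.
have fX n : f 'X^n = 0.
  elim/ltn_ind: n => n IHn; have := f_shift 'X^n.
  rewrite comp_Xn_poly XD1_exp linear_sum big_ord_recr /= big1 => [|i _].
    by rewrite linearZ /= binn mul1r; lra.
  by rewrite linearZ /= IHn ?mulr0.
rewrite -[p]coefK poly_def linear_sum big1 // => i _.
by rewrite linearZ /= fX mulr0.
Qed.

(** By linearity it suffices to treat ['X^n], where this is [Euler_rec]. *)
Lemma euler_functional_shift p :
  euler_functional (p \Po ('X + 1)) + euler_functional p = 2 * p.[0].
Proof.
rewrite -[p]coefK poly_def linear_sum !linear_sum /= -big_split /=.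
rewrite -horner_evalE linear_sum mulr_sumr; apply: eq_bigr => i _.
rewrite !linearZ /= comp_Xn_poly euler_functionalXn XD1_exp linear_sum /=.
under eq_bigr do rewrite linearZ /= euler_functionalXn.
rewrite horner_evalE hornerXn expr0n -mulrDr Euler_rec.
by case: eqP => _; rewrite ?mulr0 // mulr1 mulrC.
Qed.

(** Packaged as a linear functional so that [linear_shift_eq0] can force it to vanish. *)
Definition neg_defect (p : {poly rat}) : rat :=
  euler_functional p + euler_functional (p \Po - 'X) - 2 * p.[0].

Lemma neg_defect_is_linear : linear_for *%R neg_defect.
Proof.
move=> a p q; rewrite /neg_defect linearP linearP linearP /= hornerD hornerZ.
ring.
Qed.

HB.instance Definition _ := GRing.isLinear.Build rat {poly rat} rat *%R
  neg_defect neg_defect_is_linear.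

Lemma euler_functionalN p :
  euler_functional (p \Po - 'X) = 2 * p.[0] - euler_functional p.
Proof.
suff: neg_defect p = 0 by rewrite /neg_defect; lra.
apply: linear_shift_eq0 => {}p; rewrite /= /neg_defect.
have E1 := euler_functional_shift p.
(* Shifting [p(1 - X)] gives [p(-X)], so this instance relates exactly the two negated terms of the
   goal. *)
have := euler_functional_shift ((p \Po ('X + 1)) \Po - 'X).
have -> : ((p \Po ('X + 1)) \Po - 'X) \Po ('X + 1) = p \Po - 'X.
  rewrite -!comp_polyA; congr (_ \Po _).
  by rewrite !comp_polyD !comp_polyC !comp_polyX rmorphN /= comp_polyX; ring.
have -> : (p \Po ('X + 1)).[0] = p.[1] by rewrite horner_comp !hornerE.
have -> : ((p \Po ('X + 1)) \Po - 'X).[0] = p.[1].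
  by rewrite !(horner_comp, hornerE).
lra.
Qed.

Lemma euler_functional_reflect p :
  euler_functional (p \Po (1 - 'X))
    = euler_functional p + 2 * (p.[1] - p.[0]).
Proof.
have -> : p \Po (1 - 'X) = (p \Po ('X + 1)) \Po - 'X.
  rewrite -comp_polyA; congr (_ \Po _).
  by rewrite comp_polyD comp_polyX comp_polyC addrC.
have := euler_functional_shift p.
rewrite euler_functionalN horner_comp !hornerE.
lra.
Qed.

Lemma euler_functional_beta a b :
  euler_functional ('X^b * (1 - 'X) ^+ a)
    = \sum_(j < a.+1) ('C(a, j))%:R * (-1) ^+ j * Euler (b + j)%N.
Proof.
rewrite exprDn mulr_sumr linear_sum; apply: eq_bigr => j _.
rewrite expr1n mul1r [(- 'X) ^+ j]exprNn -euler_functionalXn.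
rewrite -[in RHS]linearZ /=; congr euler_functional.
rewrite exprD -mulr_natl -mul_polyC polyCM polyC_exp polyCN polyC1.
by rewrite polyC_natr; ring.
Qed.

Lemma euler_beta_reflect a b :
  (0 < a)%N ->
  \sum_(j < a.+1) ('C(a, j))%:R * (-1) ^+ j * Euler (b + j)%N
    = \sum_(j < b.+1) ('C(b, j))%:R * (-1) ^+ j * Euler (a + j)%N
      + (if b == 0%N then 2 else 0).
Proof.
move=> a_gt0; rewrite -!euler_functional_beta.
have -> : 'X^b * (1 - 'X) ^+ a
    = ('X^a * (1 - 'X) ^+ b) \Po (1 - 'X) :> {poly rat}.
  rewrite comp_polyM !rmorphXn /= comp_polyX rmorphB /= comp_polyX comp_polyC.
  by rewrite mulrC; congr (_ * _ ^+ _); ring.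
rewrite euler_functional_reflect !hornerE; congr (_ + _).
(* [X^a (1 - X)^b] is [0^b] at 1, and [0^a = 0] at 0 because [a > 0]. *)
rewrite !expr1n subrr !expr0n (gtn_eqF a_gt0).
by case: (b == 0%N) => /=; ring.
Qed.

Theorem corollary15 (n : nat) (m : 'I_n.+1 -> nat) :
  let N := (n * \sum_(i < n.+1) m i)%N in
  let S := (\sum_(i < n.+1 | 0 < i) i * m i)%N in
  (S < N)%N ->
  \sum_(0 <= j < (N - S).+1)
     ('C(N - S, j))%:R * (-1) ^+ j * Euler (S + j)%N
  = if S == 0%N then 2 + Euler (\sum_(i < n.+1) n * m i)%N
    else \sum_(0 <= j < S.+1)
           ('C(S, j))%:R * (-1) ^+ (S - j)%N * Euler (N - j)%N.
Proof.
move=> N S lt_SN; rewrite -big_distrr /= -/N.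
rewrite big_mkord euler_beta_reflect ?subn_gt0 //.
have [->|_] := eqVneq S 0%N.
  by rewrite big_ord1 bin0 expr0 !mul1r subn0 addn0 addrC.
(* Replacing [j] by [S - j] turns the sign into [(-1)^j] and the index [N - j] into [N - S + j]. *)
rewrite addr0 big_mkord [RHS](reindex_inj rev_ord_inj) /=.
apply: eq_bigr => j _; have le_jS : (j <= S)%N by rewrite -ltnS.
by rewrite subSS bin_sub // subKn // subnBA // addnBAC // ltnW.
Qed.
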